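(* If $G$ is a tree, then ${\rm mdim}(T(G))=2n_1(G)$, where $n_1(G)$ is the number of leaves (degree-one vertices) of $G$.
   Context: For a connected graph $H$, $d_H$ is the usual distance; for a vertex $v$ and an edge $e=ww'$, $d_H(e,v)=\min\{d_H(w,v),d_H(w',v)\}$. A set $S\subseteq V(H)$ is a mixed resolving set if for every two distinct elements $x,y\in V(H)\cup E(H)$ there is $v\in S$ with $d_H(x,v)\ne d_H(y,v)$; ${\rm mdim}(H)$ is the minimum cardinality of a mixed resolving set. The total graph $T(G)$ has vertex set $V(G)\cup\{v_e: e\in E(G)\}$, and its edges are: all edges of $G$; the edges $xv_e$ for each $e\in E(G)$ and each endvertex $x$ of $e$; and the edges $v_ev_f$ for distinct edges $e,f$ of $G$ sharing an endvertex.
   Formalization: The tree G is assumed not to have exactly two vertices: for G = K_2 the total graph is K_3, whose mixed metric dimension is 3, while 2n_1(G) = 4. *)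

(* Defs.v *)
From HB Require Import structures.
From mathcomp Require Import all_boot.

Set Implicit Arguments.
Unset Strict Implicit.
Unset Printing Implicit Defensive.

Record sgraph := SGraph {
  vert :> finType;
  adj : rel vert;
  adj_sym : symmetric adj;
  adj_irr : irreflexive adj
}.

Section Graph.
Variable H : sgraph.
Implicit Types x y v : H.

Definition is_edge (A : {set H}) : bool :=
  [exists x, exists y, adj x y && (A == [set x; y])].

(* The edge set E(H), as a finType: an edge is the 2-set of its ends. *)
Definition edge : finType := {A : {set H} | is_edge A}.

Definition has_walk (k : nat) x y : bool :=
  [exists p : k.-tuple H, path (@adj H) x p && (last x p == y)].

(* The least length of a walk from x to y.  If x and y are connected, this
   length is < #|H|; otherwise the junk value is #|H|. *)
Definition dist x y : nat := find (fun k => has_walk k x y) (iota 0 #|H|).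

(* The minimum of [dist w v] over the two ends w of e; the default #|H| of the
   iterated minimum is neutral, since dist is bounded by #|H|. *)
Definition edge_dist (e : edge) v : nat :=
  \big[minn/#|H|]_(w in val e) dist w v.

(* [inl x] is the vertex x, [inr e] the edge e. *)
Definition elt_dist (a : H + edge) v : nat :=
  match a with inl x => dist x v | inr e => edge_dist e v end.

Definition mixed_resolving (S : {set H}) : bool :=
  [forall a : H + edge, forall b : H + edge,
     (a != b) ==> [exists v in S, elt_dist a v != elt_dist b v]].

(* The minimisation is over a nonempty family: [mixed_resolving_setT] below. *)
Definition mdim : nat :=
  #|[arg min_(S < [set: H] | mixed_resolving S) #|S| ]|.

Definition connected : Prop := forall x y, connect (@adj H) x y.

(* [ucycle] also accepts the empty sequence and, by symmetry of adj, [:: x; y]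
   for an edge xy; these are not cycles of the graph. *)
Definition acyclic : Prop :=
  forall p : seq H, ucycle (@adj H) p -> size p <= 2.

Definition is_tree : Prop := [/\ 0 < #|H|, connected & acyclic].

Definition degree x : nat := #|[set y | adj x y]|.

Definition num_leaves : nat := #|[set x : H | degree x == 1]|.

End Graph.

Section TotalGraph.
Variable G : sgraph.

(* [inl x] is the vertex x of G, [inr e] the new vertex v_e. *)
Definition total_adj (a b : G + edge G) : bool :=
  match a, b with
  | inl x, inl y => adj x y
  | inl x, inr e => x \in val e
  | inr e, inl x => x \in val e
  | inr e, inr f => (e != f) && (val e :&: val f != set0)
  end.

Lemma total_adj_sym : symmetric total_adj.
Proof.
move=> [x|e] [y|f] //=; first exact: adj_sym.
by rewrite eq_sym setIC.
Qed.

Lemma total_adj_irr : irreflexive total_adj.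
Proof. by case=> [x|e] /=; rewrite ?adj_irr ?eqxx. Qed.

Definition total_graph : sgraph :=
  @SGraph (G + edge G)%type total_adj total_adj_sym total_adj_irr.

End TotalGraph.

Section Facts.
Variable H : sgraph.
Implicit Types (x y v : H) (e f : edge H).

Lemma dist_le_card x y : dist x y <= #|H|.
Proof. by rewrite -[X in _ <= X](size_iota 0) find_size. Qed.

Lemma has_walkP k x y :
  reflect (exists p, [/\ path (@adj H) x p, last x p = y & size p = k])
          (has_walk k x y).
Proof.
apply: (iffP existsP) => [[p /andP[xp /eqP py]]|[p [xp py /eqP sp]]].
  by exists p; rewrite size_tuple.
by exists (Tuple sp); rewrite /= xp py eqxx.
Qed.

Lemma dist_min k x y : has_walk k x y -> dist x y <= k.
Proof.
move=> kxy; case: (ltnP k #|H|) => [lt_k|le_k].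
  rewrite leqNgt; apply/negP => /(before_find 0).
  by rewrite nth_iota // add0n kxy.
exact: leq_trans (dist_le_card x y) le_k.
Qed.

Lemma dist_walk x y : connect (@adj H) x y -> has_walk (dist x y) x y.
Proof.
case/connectP=> p xp ->; case: (shortenP xp) => q xq uq _.
have lt_q : size q < #|H|.
  by rewrite -[(size q).+1]/(size (x :: q)) -(card_uniqP uq) max_card.
have: has (fun k => has_walk k x (last x q)) (iota 0 #|H|).
  apply/hasP; exists (size q); first by rewrite mem_iota.
  by apply/has_walkP; exists q.
move=> hq; have := nth_find 0 hq.
by rewrite nth_iota // -[X in _ < X](size_iota 0) -has_find.
Qed.

Lemma dist_eq0 x y : (dist x y == 0) = (x == y).
Proof.
have H0 : 0 < #|H| by apply/card_gt0P; exists x.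
apply/idP/eqP => [d0|->].
  have: has_walk 0 x y.
    move: d0; rewrite /dist; case: #|H| H0 => //= n _.
    by case: (has_walk 0 x y).
  by move=> /has_walkP[[|z p] []].
by rewrite -leqn0; apply: dist_min; apply/has_walkP; exists [::].
Qed.

Lemma leq_edge_dist m e v :
  (m <= edge_dist e v) = (m <= #|H|) && [forall w in val e, m <= dist w v].
Proof.
have -> : [forall w in val e, m <= dist w v] =
    all (fun w => (w \in val e) ==> (m <= dist w v)) (index_enum H).
  apply/forallP/allP => [h w _|h w]; first exact: h.
  exact/h/mem_index_enum.
rewrite /edge_dist; elim: (index_enum H) => [|w r IHr] /=.
  by rewrite big_nil andbT.
by rewrite big_cons; case: (w \in val e) => //=; rewrite leq_min IHr andbCA.
Qed.

Lemma edge_distE e x y v :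
  val e = [set x; y] -> edge_dist e v = minn (dist x v) (dist y v).
Proof.
move=> exy; have le_edge m :
    (m <= edge_dist e v) = (m <= minn (dist x v) (dist y v)).
  rewrite leq_edge_dist exy leq_min; apply/andP/andP => [[_ /forall_inP h]|].
    by split; apply: h; rewrite !inE eqxx ?orbT.
  case=> mx my; split; first exact: leq_trans mx (dist_le_card x v).
  by apply/forall_inP => w /set2P[] ->.
by apply/eqP; rewrite eqn_leq -le_edge leqnn le_edge leqnn.
Qed.

Lemma edge_neq e : exists x y, [/\ x != y, adj x y & val e = [set x; y]].
Proof.
have /existsP[x /existsP[y /andP[xy /eqP exy]]] := valP e.
by exists x, y; split=> //; apply: contraTneq xy => ->; rewrite adj_irr.
Qed.

Lemma mixed_resolving_setT : mixed_resolving [set: H].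
Proof.
suff elt_zeros (a : H + edge H) :
    [set v | elt_dist a v == 0] = match a with inl x => [set x] | inr e => val e end.
  apply/forallP=> a; apply/forallP=> b; apply/implyP => nab.
  apply: contraNT nab.
  rewrite negb_exists_in => /forall_inP eq_d.
  have : [set v | elt_dist a v == 0] = [set v | elt_dist b v == 0].
    by apply/setP=> v; rewrite !inE (eqP (negbNE (eq_d v (in_setT v)))).
  rewrite !elt_zeros.
  have set1_edge x e : [set x] = val e -> False.
    have [u [w [nuw _ ->]]] := edge_neq e.
    by move/(congr1 (fun A : {set H} => #|A|)); rewrite cards1 cards2 nuw.
  case: a b {eq_d} => [x|e] [y|f].
  - by move/set1_inj->.
  - by move/set1_edge.
  - by move/esym/set1_edge.
  - by move/val_inj->.
apply/setP=> v; rewrite inE; case: a => [x|e] /=.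
  by rewrite dist_eq0 inE eq_sym.
have [u [w [_ _ euw]]] := edge_neq e.
rewrite (edge_distE v euw) euw !inE [v == u]eq_sym [v == w]eq_sym -!dist_eq0.
by rewrite -!leqn0 geq_min.
Qed.

End Facts.

(* Main.v *)
(* The total graph T(G) is the square of the subdivision S of G, so that
   d_T = uphalf d_S, and S is again a tree.

   Lower bound: if u and w are adjacent and N[u] is contained in N[w], only u
   can tell w from the edge uw, so u lies in every mixed resolving set.  This
   applies to each leaf x (with w the vertex of its pendant edge e) and to v_e
   (with w the other end of e).

   Upper bound: for a leaf x with pendant edge e, d_T(-, x) and d_T(-, v_e)
   together determine d_S(-, x).  In the tree S, the distances from a set
   {a, a'} to all leaves determine it: choose a leaf l beyond a as seen from a';
   if {b, b'} is equally close to l but avoids a, one of its points, c, lies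
   beyond a from a', and it is strictly closer than a and a' to a leaf beyond c. *)

Require Import Defs.
From mathcomp Require Import all_boot.
From mathcomp Require Import zify.

Set Implicit Arguments.
Unset Strict Implicit.
Unset Printing Implicit Defensive.

(** * Edges and their ends *)

Lemma edge_of_adj (H : sgraph) (x y : H) :
  adj x y -> exists e : edge H, val e = [set x; y].
Proof.
move=> xy; have exy : is_edge [set x; y].
  by apply/existsP; exists x; apply/existsP; exists y; rewrite xy eqxx.
by exists (Sub _ exy : edge H); rewrite SubK.
Qed.

Lemma edge_other_end (H : sgraph) (e : edge H) x :
  x \in val e -> exists2 y, adj x y & val e = [set x; y].
Proof.
have [u [w [_ uw ->]]] := edge_neq e.
case/set2P=> ->; first by exists w.
by exists u; [rewrite adj_sym | rewrite setUC].
Qed.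

(** * Distances, cuts and leaves in a connected graph *)

Section Metric.
Variable H : sgraph.
Hypothesis connH : connected H.
Implicit Types (a b p q r u v x y z l : H) (C S : {set H}).

Lemma dist_triangle y x z : dist x z <= dist x y + dist y z.
Proof.
have /has_walkP[p [xp py <-]] := dist_walk (connH x y).
have /has_walkP[q [yq qz <-]] := dist_walk (connH y z).
rewrite -size_cat; apply/dist_min/has_walkP; exists (p ++ q).
by rewrite cat_path last_cat py xp.
Qed.

Lemma dist_sym x y : dist x y = dist y x.
Proof.
suff le_d u v : dist v u <= dist u v by apply/eqP; rewrite eqn_leq !le_d.
have /has_walkP[p [up <- <-]] := dist_walk (connH u v).
apply/dist_min/has_walkP; exists (rev (belast u p)).
rewrite rev_path size_rev size_belast.
split=> //; first by rewrite (eq_path (e' := @adj H)) // => ? ?; apply: adj_sym.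
by case: p {up} => //= w p; rewrite rev_cons last_rcons.
Qed.

Lemma distxx x : dist x x = 0.
Proof. by apply/eqP; rewrite dist_eq0. Qed.

Lemma dist_gt0 x y : (0 < dist x y) = (x != y).
Proof. by rewrite lt0n dist_eq0. Qed.

Lemma adj_dist_le1 x y : adj x y -> dist x y <= 1.
Proof.
by move=> xy; apply/dist_min/has_walkP; exists [:: y]; rewrite /= xy.
Qed.

Lemma dist_step x y : x != y -> exists2 z, adj x z & dist z y < dist x y.
Proof.
move=> nxy; have /has_walkP[[|z p] [/= xp py sp]] := dist_walk (connH x y).
  by rewrite py eqxx in nxy.
case/andP: xp => xz zp; exists z; rewrite // -sp ltnS.
by apply/dist_min/has_walkP; exists p.
Qed.

(** A shortest path from [u] to any [v != u] first steps to [w] or to a neighbour of [w]. So [w] is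
    at least as near to [v] as [u] is, and the edge joining them has the same distance to [v] as
    [w]. *)
Lemma dominated_in_resolving S u w :
  adj u w -> (forall z, adj u z -> z = w \/ adj w z) ->
  mixed_resolving S -> u \in S.
Proof.
move=> uw dom resS; have [e euw] := edge_of_adj uw.
have /forallP/(_ (inr e))/implyP/(_ isT) := forallP resS (inl w).
case/exists_inP=> v vS /=; rewrite (edge_distE v euw).
have [->//|nuv] := eqVneq u v; rewrite (minn_idPr _) ?eqxx //.
have [z /dom wz lt_z] := dist_step nuv.
case: wz => [<-|/adj_dist_le1 wz]; first exact: ltnW.
have := dist_triangle z w v; lia.
Qed.

(* [C] is the side of [v] after the bridge [uv] is deleted. *)
Definition cut u v C :=
  [/\ u \notin C, v \in C &
      forall p q, p \in C -> q \notin C -> adj p q -> p = v /\ q = u].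

(** A walk can enter [C] only by the step from [u] to [v]; the bound splits the walk there. *)
Lemma cut_dist u v C p q :
  cut u v C -> p \notin C -> q \in C ->
  dist p u + (dist v q).+1 <= dist p q.
Proof.
case=> _ _ cutC + qC.
have /has_walkP[s [ps sq <-]] := dist_walk (connH p q).
elim: s p ps sq => [|z s IHs] p /=; first by move=> _ ->; rewrite qC.
case/andP=> pz zs sq pC; have [zC|zC] := boolP (z \in C).
  - have [zv pu] : z = v /\ p = u by apply: cutC; rewrite // adj_sym.
    by rewrite pu distxx add0n ltnS -zv; apply/dist_min/has_walkP; exists s.
- have := IHs z zs sq zC; have := adj_dist_le1 pz; have := dist_triangle z p u.
  lia.
Qed.

(** Replaces acyclicity: it yields distance estimates through [cut_dist] and passes to the
    subdivision without any handling of cycles. *)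
Definition all_bridges := forall u v, adj u v -> exists C, cut u v C.

Hypothesis bridgeH : all_bridges.

(** Delete the bridge to a neighbour [z1]: maximality puts [r] on the side of [z1], and any other
    neighbour would lie beyond [l], hence further from [r]. *)
Lemma local_max_degree r l :
  (forall z, adj l z -> dist r z <= dist r l) -> degree l <= 1.
Proof.
move=> max_l; apply/card_le1_eqP => z1 z2; rewrite !inE => lz1 lz2.
have z1l : adj z1 l by rewrite adj_sym.
have [C cutC] := bridgeH z1l; have [z1C lC crossC] := cutC.
have rC : r \notin C.
  apply/negP => rC; have := cut_dist cutC z1C rC.
  by have := max_l _ lz1; rewrite distxx (dist_sym z1) (dist_sym l); lia.
apply/eqP/contraT => nz; have z2C : z2 \in C.
  by apply: contraNT nz => z2C; have [_ ->] := crossC _ _ lC z2C lz2.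
have := cut_dist cutC rC z2C; have := max_l _ lz2.
have := dist_triangle z1 r l; have := adj_dist_le1 z1l.
have : 0 < dist l z2.
  by rewrite dist_gt0; apply: contraTneq lz2 => ->; rewrite adj_irr.
lia.
Qed.

(** Among the vertices behind [a] as seen from [r], one furthest from [a] is a local maximum of the
    distance from [r]. The bound [<= 1] allows for the one-vertex graph. *)
Lemma leaf_beyond r a :
  exists2 l, degree l <= 1 & dist r l = dist r a + dist a l.
Proof.
pose B := [pred q | dist r q == dist r a + dist a q].
have aB : B a by rewrite /= distxx addn0.
case: (arg_maxnP (dist a) aB) => l /eqP/= lB max_l; exists l => //.
apply: (@local_max_degree r) => z lz; rewrite leqNgt; apply/negP => lt_z.
have := adj_dist_le1 lz; have := dist_triangle l a z.
have := dist_triangle a r z => ra al lz1.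
have /max_l : B z by rewrite /=; apply/eqP; lia.
by rewrite leqNgt => /negP; apply; lia.
Qed.

(** The bridge from [a] to its neighbour [u] towards [r] separates [r] from [l]. A point [b] on the
    side of [r] would reach [l] only through [a], so it would be strictly further from [l] than
    [a]. *)
Lemma between_of_closer r a b l :
  dist r l = dist r a + dist a l -> dist b l <= dist a l ->
  dist r b = dist r a + dist a b.
Proof.
move=> ral bal; have [->|nar] := eqVneq a r; first by rewrite distxx.
have [u au lt_u] := dist_step nar; have ua : adj u a by rewrite adj_sym.
have [C cutC] := bridgeH ua; have [uC _ _] := cutC.
have rC : r \notin C.
  apply/negP => rC; have := cut_dist cutC uC rC.
  rewrite distxx; lia.
have lC : l \in C.
  apply/contraT => lC; have aC : a \in C by case: cutC.
  have := cut_dist cutC lC aC; have := dist_triangle u r l.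
  rewrite distxx (dist_sym l) (dist_sym l) (dist_sym r u) ?(dist_sym r a).
  by move: ral; rewrite (dist_sym r a); lia.
have bC : b \in C.
  by apply/contraT => bC; have := cut_dist cutC bC lC; lia.
have := cut_dist cutC rC bC; have := dist_triangle a r b.
have := dist_triangle u r a; have := adj_dist_le1 ua; lia.
Qed.

Lemma leaf_dists_determine a a' b b' :
  (forall l, degree l = 1 ->
     minn (dist a l) (dist a' l) = minn (dist b l) (dist b' l)) ->
  a \in [set b; b'].
Proof.
move=> eq_leaf; apply/contraT; rewrite !inE negb_or => /andP[nab nab'].
(* Since [a != b], there is a second vertex, so connectedness excludes degree zero. *)
have leafP l : degree l <= 1 -> degree l = 1.
  move=> l1; apply/eqP; rewrite eqn_leq l1 /=; apply/card_gt0P.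
  have [x nlx] : exists x, l != x.
    by have [->|] := eqVneq l a; [exists b | exists a].
  by have [z lz _] := dist_step nlx; exists z; rewrite inE.
have [l /leafP/eq_leaf eq_l al] := leaf_beyond a' a.
(* [c] is whichever of [b] and [b'] is nearer to [l]. *)
have [c [nac ca eq_c]] : exists c, [/\ a != c, dist c l <= dist a l &
    forall l, minn (dist b l) (dist b' l) <= dist c l].
  have [le_b|lt_b] := leqP (dist b l) (dist b' l).
    by exists b; split=> // [|z]; [|apply: geq_minl]; lia.
  by exists b'; split=> // [|z]; [|apply: geq_minr]; lia.
have a'c := between_of_closer al ca.
(* On the way from [a'] to [k] come first [a], then [c != a]; so [c] is strictly nearer to [k] than
   both [a] and [a'], against [eq_k]. *)
have [k /leafP/eq_leaf eq_k a'k] := leaf_beyond a' c.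
have := eq_c k; have := dist_triangle a a' k.
by move: nac; rewrite -dist_gt0; lia.
Qed.

End Metric.

(** * From acyclicity to bridges *)

Lemma tree_all_bridges (G : sgraph) : is_tree G -> all_bridges G.
Proof.
case=> _ _ acyG u v uv.
(* Deleting the arc vu in one direction only is enough. *)
pose e' := [rel p q : G | adj p q && ~~ ((p == v) && (q == u))].
exists [set z | connect e' v z]; split; rewrite ?inE ?connect0 //; last first.
  move=> p q; rewrite !inE => vp nvq pq.
  suff /andP[/eqP-> /eqP->] : (p == v) && (q == u) by [].
  apply: contraNT nvq => npq; apply: connect_trans vp (connect1 _).
  by rewrite /= pq.
(* A simple path from [v] to [u] avoiding the deleted arc, closed by the edge, would be a cycle with
   at least three vertices. *)
apply/negP => /connectP[s vs us]; case: (shortenP vs) us => t vt ut _ eu.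
have sub : subrel e' (@adj G) by move=> p q /andP[].
have /acyG : ucycle (@adj G) (v :: t).
  by rewrite /ucycle ut andbT /= rcons_path (sub_path sub vt) -eu.
case: t vt ut eu => [|w [|]] //= vt _ eu; first by rewrite eu adj_irr in uv.
by move: vt; rewrite eu !eqxx andbF.
Qed.

(** * The subdivision and its square, the total graph *)

Section Subdivision.
Variable G : sgraph.

Definition subdivision_adj (a b : G + edge G) : bool :=
  match a, b with
  | inl x, inr e | inr e, inl x => x \in val e
  | _, _ => false
  end.

Lemma subdivision_adj_sym : symmetric subdivision_adj.
Proof. by case=> ? [] ?. Qed.

Lemma subdivision_adj_irr : irreflexive subdivision_adj.
Proof. by case. Qed.

Definition subdivision : sgraph :=
  @SGraph (G + edge G)%type _ subdivision_adj_sym subdivision_adj_irr.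

Lemma subdivision_all_bridges : all_bridges G -> all_bridges subdivision.
Proof.
move=> bridgeG.
have half_edge x (e : edge G) :
    x \in val e -> exists C, @cut subdivision (inl x) (inr e) C.
  move=> xe; have [y xy exy] := edge_other_end xe.
  have [C [xC yC crossC]] := bridgeG _ _ xy.
  (* An edge node joins the side of [C] as soon as one end of the edge does. So [e] goes with [y],
     and only the half from [x] to [e] is cut. *)
  pose side (a : subdivision) := match a with
    inl z => z \in C | inr f => val f :&: C != set0 end.
  exists [set a | side a]; split; rewrite ?inE //=.
    by apply/set0Pn; exists y; rewrite exy !inE eqxx orbT.
  case=> [z|f] [w|g]; rewrite !inE //=.
    by move=> zC + zg; case/negP; apply/set0Pn; exists z; rewrite inE zg.
  case/set0Pn=> z /setIP[zf zC] wC wf.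
  have [t zt fE] := edge_other_end zf.
  move: wf; rewrite fE => /set2P[wz|wt]; first by rewrite wz zC in wC.
  rewrite -wt in zt fE; have [zy wx] := crossC _ _ zC wC zt.
  by split; [congr inr; apply: val_inj; rewrite fE zy wx setUC exy | rewrite wx].
case=> [x|e] [y|f] //=; first exact: half_edge.
move=> ye; have [C [yC eC crossC]] := half_edge _ _ ye.
(* The complement serves the reversed orientation. *)
exists (~: C); split; rewrite ?inE ?negbK //.
move=> p q; rewrite !inE negbK => pC qC pq.
by rewrite adj_sym in pq; have [-> ->] := crossC q p qC pC pq.
Qed.

Hypothesis connG : connected G.

Lemma subdivision_connected : connected subdivision.
Proof.
have symS : connect_sym (@adj subdivision) by exact/sym_connect_sym/adj_sym.
have connV x y : connect (@adj subdivision) (inl x) (inl y).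
  have /connectP[p xp ->] := connG x y.
  elim: p x xp => [|z p IHp] x /=; first by rewrite connect0.
  case/andP=> xz /IHp; apply: connect_trans; have [e exz] := edge_of_adj xz.
  apply: (@connect_trans _ _ (inr e)); apply: connect1;
    by rewrite /= exz !inE eqxx ?orbT.
have near a : exists x, connect (@adj subdivision) a (inl x).
  case: a => [x|e]; first by exists x; apply: connect0.
  have [x [y [_ _ exy]]] := edge_neq e; exists x; apply: connect1.
  by rewrite /= exy !inE eqxx.
move=> a b; have [x ax] := near a; have [y by_] := near b.
apply: connect_trans ax (connect_trans (connV x y) _).
by rewrite symS.
Qed.

Lemma total_adj_of_subdivision (a b : G + edge G) :
  @adj subdivision a b -> @adj (total_graph G) a b.
Proof. by case: a b => [x|e] [y|f]. Qed.

Lemma subdivision_step2 (a c b : subdivision) :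
  adj a c -> adj c b -> a = b \/ @adj (total_graph G) a b.
Proof.
case: a c b => [x|e] [w|g] [y|f] //=.
  move=> xg; have [t xt ->] := edge_other_end xg.
  by case/set2P=> ->; [left | right].
move=> we wf; have [->|nef] := eqVneq e f; [by left | right=> /=].
by apply/set0Pn; exists w; rewrite inE we.
Qed.

Lemma total_adj_subdivision (a b : total_graph G) :
  adj a b -> @dist subdivision a b <= 2.
Proof.
have two (c : subdivision) : @adj subdivision a c -> @adj subdivision c b ->
    @dist subdivision a b <= 2.
  move=> ac cb; apply/dist_min/has_walkP; exists [:: c; b].
  by split=> //; move: ac cb => /= -> ->.
case: a b two => [x|e] [y|f] /= two.
- case/edge_of_adj=> e exy.
  by apply: (two (inr e)); rewrite /= exy !inE eqxx ?orbT.
- by move=> xf; apply/leqW/adj_dist_le1.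
- by move=> ye; apply/leqW/adj_dist_le1.
- by case/andP=> _ /set0Pn[x /setIP[xe xf]]; apply: (two (inl x)).
Qed.

Lemma total_connected : connected (total_graph G).
Proof.
move=> a b; have := subdivision_connected a b; apply: connect_sub => p q pq.
exact/connect1/total_adj_of_subdivision.
Qed.

(** Two successive steps in the subdivision merge into at most one step of the total graph, a last
    odd step costing one; conversely, each step of the total graph expands to at most two. *)
Lemma total_dist (a b : G + edge G) :
  @dist (total_graph G) a b = uphalf (@dist subdivision a b).
Proof.
apply/eqP; rewrite eqn_leq; apply/andP; split.
  have /has_walkP[p [ap <- <-]] := dist_walk (subdivision_connected a b).
  (* Strong induction on the length, since merging consumes two steps at once. *)
  elim: (size p).+1 {-2}p (ltnSn (size p)) a ap => // n IHn {}p.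
  case: p => [|c [|d p]] lt_n a /=; first by rewrite distxx.
    by rewrite andbT => ac; apply/adj_dist_le1/total_adj_of_subdivision.
  case/and3P=> ac cd dp; have IH := IHn p (ltnW lt_n) d dp.
  have [->|ad] := subdivision_step2 ac cd; first exact: leqW.
  have := dist_triangle total_connected (d : total_graph G) a (last d p).
  move=> /leq_trans; apply; rewrite -add1n.
  by apply: leq_add => //; apply: adj_dist_le1.
suff : @dist subdivision a b <= (@dist (total_graph G) a b).*2.
  by rewrite leq_uphalf_double.
have /has_walkP[p [ap <- <-]] := dist_walk (total_connected a b).
elim: p a ap => [|c p IHp] a /=; first by rewrite distxx.
case/andP=> /total_adj_subdivision ac /IHp IH.
apply: leq_trans (dist_triangle subdivision_connected c a _) _.
by rewrite doubleS -add2n; apply: leq_add.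
Qed.

End Subdivision.

(** * Leaves, pendant edges and their number *)

Section Pendant.
Variable G : sgraph.

Definition pendant_elements : {set total_graph G} :=
  [set a : G + edge G | match a with
    | inl x => degree x == 1
    | inr e => [exists x in val e, degree x == 1]
    end].

Lemma leaf_edge (x : G) : degree x = 1 ->
  exists e y, [/\ adj x y, val e = [set x; y] &
                  forall f : edge G, x \in val f -> f = e].
Proof.
move/eqP/cards1P=> [y Ny]; have nbr z : adj x z = (z == y).
  by have := in_set1 z y; rewrite -Ny inE.
have xy : adj x y by rewrite nbr.
have [e exy] := edge_of_adj xy; exists e, y; split=> // f.
case/edge_other_end=> z; rewrite nbr => /eqP-> fxy.
by apply: val_inj; rewrite fxy exy.
Qed.

Hypothesis connG : connected G.

(** Two adjacent leaves have no other neighbours, so by connectedness they are the whole graph. *)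
Lemma leaves_not_adj (x y : G) :
  #|G| != 2 -> degree x = 1 -> degree y = 1 -> ~~ adj x y.
Proof.
move=> G2 x1 y1; apply: contra G2 => xy.
have nbr (u v w : G) : degree u = 1 -> adj u v -> adj u w -> w = v.
  by move/eqP/cards1P=> [t /setP Nu]; move: (Nu v) (Nu w);
    rewrite !inE => -> -> /eqP-> /eqP->.
have closed_xy : closed (@adj G) [set x; y].
  apply: intro_closed; first exact/sym_connect_sym/adj_sym.
  move=> u v uv /set2P[] eu; rewrite eu in uv; rewrite !inE.
    by rewrite (nbr x y v) ?eqxx ?orbT.
  by rewrite (nbr y x v) ?eqxx // adj_sym.
have -> : #|G| = #|[set x; y]|.
  apply: eq_card => z; rewrite -(closed_connect closed_xy (connG x z)).
  by rewrite !inE eqxx.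
by rewrite cards2 (_ : x != y) //; apply: contraTneq xy => ->; rewrite adj_irr.
Qed.

(** Sending a leaf to its pendant edge is injective unless two leaves are adjacent. In the excluded
    graph $K_2$ both leaves share one edge, leaving three elements instead of four. *)
Lemma card_pendant_elements :
  #|G| != 2 -> #|pendant_elements| = 2 * num_leaves G.
Proof.
move=> G2; rewrite -sum1_card big_sumType /= mul2n -addnn.
have -> : \sum_(x : G | inl x \in pendant_elements) 1 = num_leaves G.
  by rewrite /num_leaves -sum1_card; apply: eq_bigl => x; rewrite !inE.
(* [pick] takes values in [option], so the pendant edges are counted after embedding by [Some]. *)
congr (_ + _); rewrite sum1dep_card -(card_imset _ (@Some_inj _)).
pose pend x := [pick e : edge G | x \in val e].
have pendE x (e : edge G) : degree x = 1 -> x \in val e -> pend x = Some e.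
  move=> x1 xe; rewrite /pend; case: pickP => [f xf|/(_ e)]; last by rewrite xe.
  have [g [_ [_ _ uniq_g]]] := leaf_edge x1.
  by rewrite (uniq_g e xe) (uniq_g f xf).
have <- : #|pend @: [set x : G | degree x == 1]| = num_leaves G.
  apply: card_in_imset => x y; rewrite !inE => /eqP x1 /eqP y1.
  have [e [z [xz exz uniq_e]]] := leaf_edge x1.
  rewrite (pendE x e) ?exz ?inE ?eqxx // /pend.
  case: pickP => // f yf [ef]; move: yf; rewrite -ef exz => /set2P[//|yz].
  by have := leaves_not_adj G2 x1 y1; rewrite yz xz.
congr #|pred_of_set _|; apply/setP => o; apply/imsetP/imsetP => [] [].
  move=> e; rewrite !inE => /exists_inP[x xe /eqP x1] ->.
  by exists x; [rewrite inE x1 | rewrite (pendE x e)].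
move=> x; rewrite inE => /eqP x1 ->; have [e [y [_ exy _]]] := leaf_edge x1.
have xe : x \in val e by rewrite exy !inE eqxx.
exists e; last exact: pendE.
by rewrite !inE; apply/exists_inP; exists x; rewrite ?x1.
Qed.

(** * Lower bound: vertices forced into every mixed resolving set *)

Lemma pendant_elements_forced (S : {set total_graph G}) :
  mixed_resolving S -> pendant_elements \subset S.
Proof.
move=> resS; have connT := total_connected connG.
have forced := dominated_in_resolving connT _ _ resS.
apply/subsetP; case=> [x|e]; rewrite inE /=.
  move/eqP=> x1; have [e [y [xy exy uniq_e]]] := leaf_edge x1.
  have xe : x \in val e by rewrite exy !inE eqxx.
  apply: (forced _ (inr e)) => //= -[z|f] /=; last by move/uniq_e->; left.
  move=> xz; right; have [f fxz] := edge_of_adj xz.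
  by rewrite -(uniq_e f) fxz !inE eqxx ?orbT.
case/exists_inP=> x xe /eqP x1; have [g [y [xy gxy uniq_g]]] := leaf_edge x1.
have eg := uniq_g e xe; have exy : val e = [set x; y] by rewrite eg.
apply: (forced _ (inl y)) => [|[z|f]] /=.
- by rewrite exy !inE eqxx orbT.
- by rewrite exy => /set2P[] ->; [right; rewrite adj_sym | left].
- case/andP=> nef /set0Pn[w]; rewrite inE exy => /andP[/set2P[] ->].
    by move/uniq_g=> fg; rewrite fg eg eqxx in nef.
  by right.
Qed.

(** * Upper bound: recovering an element from its distances *)

Definition ends (H : sgraph) (a : H + edge H) : {set H} :=
  match a with inl x => [set x] | inr e => val e end.

Lemma ends_inj (H : sgraph) : injective (@ends H).
Proof.
have set1_edge (x : H) (e : edge H) : [set x] <> val e.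
  have [u [w [nuw _ ->]]] := edge_neq e.
  by move/(congr1 (fun A : {set H} => #|A|)); rewrite cards1 cards2 nuw.
case=> [x|e] [y|f] /=.
- by move/set1_inj->.
- by move/set1_edge.
- by move/esym/set1_edge.
- by move/val_inj->.
Qed.

(** Taking [p = q] for a vertex gives vertices and edges the common shape required by
    [leaf_dists_determine]. *)
Lemma elt_dist_ends (H : sgraph) (a : H + edge H) :
  exists p q, ends a = [set p; q] /\
    forall v, elt_dist a v = minn (dist p v) (dist q v).
Proof.
case: a => [x|e] /=.
  by exists x, x; rewrite setUid; split=> // v; rewrite minnn.
have [x [y [_ _ exy]]] := edge_neq e.
by exists x, y; split=> // v; apply: edge_distE.
Qed.

(** The node of [e] is the only neighbour of the leaf [x] in the subdivision, so every path to [x]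
    ends through it. *)
Lemma pendant_dist (x : G) (e : edge G) (a : subdivision G) :
  degree x = 1 -> x \in val e -> a != inl x ->
  @dist (subdivision G) a (inl x) = (@dist (subdivision G) a (inr e)).+1.
Proof.
move=> x1 xe nax; have connS := subdivision_connected connG.
have [g [_ [_ _ uniq_g]]] := leaf_edge x1.
apply/eqP; rewrite eqn_leq; apply/andP; split.
  apply: leq_trans (dist_triangle connS (inr e : subdivision G) _ _) _.
  by rewrite -addn1 leq_add2l; apply: adj_dist_le1.
have nxa : (inl x : subdivision G) != a by rewrite eq_sym.
have [z xz lt_z] := dist_step connS nxa.
have [f zf xf] : exists2 f, z = inr f & x \in val f.
  by case: z xz {lt_z} => [y|f] // xf; exists f.
have fe : f = e by rewrite (uniq_g e xe) (uniq_g f xf).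
by rewrite (dist_sym connS a) (dist_sym connS a) -fe -zf.
Qed.

(** An edge node has both its ends as neighbours, hence degree at least two. *)
Lemma subdivision_leaf (l : subdivision G) :
  degree l = 1 -> exists2 x, l = inl x & degree x = 1.
Proof.
move/eqP/cards1P=> [k Nl]; have nbr c : adj l c -> c = k.
  by move=> lc; apply/set1P; rewrite -Nl inE.
have {Nl} : adj l k by have := set11 k; rewrite -Nl inE.
case: l nbr => [x|e] nbr; last first.
  have [y [z [nyz _ eyz]]] := edge_neq e => _.
  have [yk zk] : inl y = k /\ inl z = k.
    by split; apply: nbr; rewrite /= eyz !inE eqxx ?orbT.
  by case/eqP: nyz; apply: (@inl_inj _ (edge G)); rewrite yk zk.
case: k nbr => // e nbr /edge_other_end[y xy exy]; exists x => //.
apply/eqP/cards1P; exists y; apply/setP=> z; rewrite !inE.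
apply/idP/eqP => [xz|->//]; have [f fxz] := edge_of_adj xz.
have [fe] : @inr G _ f = inr e by apply: nbr; rewrite /= fxz !inE eqxx.
have : z \in val e by rewrite -fe fxz !inE eqxx orbT.
by rewrite exy => /set2P[zx|//]; rewrite zx adj_irr in xz.
Qed.

Lemma pendant_elements_resolving :
  all_bridges G -> mixed_resolving pendant_elements.
Proof.
move=> bridgeG; have connS := subdivision_connected connG.
have bridgeS := subdivision_all_bridges bridgeG.
pose dS := @dist (subdivision G).
apply/forallP=> a; apply/forallP=> b; apply/implyP; apply: contraNT.
rewrite negb_exists_in => /forall_inP eq_ab; apply/eqP/ends_inj.
have [p [q [-> da]]] := elt_dist_ends a.
have [r [s [-> db]]] := elt_dist_ends b.
have eq_leaf l : @degree (subdivision G) l = 1 ->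
    minn (dS p l) (dS q l) = minn (dS r l) (dS s l).
  case/subdivision_leaf=> x -> x1.
  have [e [y [_ exy _]]] := leaf_edge x1.
  have xe : x \in val e by rewrite exy !inE eqxx.
  have near t :
      dS t (inl x) = if dS t (inl x) is 0 then 0 else (dS t (inr e)).+1.
    have [->|ntx] := eqVneq t (inl x); first by rewrite /dS distxx.
    by rewrite /dS (pendant_dist x1 xe ntx).
  (* As [uphalf n + uphalf n.+1 = n.+1], the two total-graph distances add up to the subdivision
     distance to [x]; this is compatible with minima. The value at [j = 0] treats [x] itself, where
     the sum would be 1. *)
  pose total i j := if j is k.+1 then i + j else 0.
  have near2 t u : minn (dS t (inl x)) (dS u (inl x)) =
      total (minn (uphalf (dS t (inr e))) (uphalf (dS u (inr e))))
            (minn (uphalf (dS t (inl x))) (uphalf (dS u (inl x)))).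
    rewrite /total.
    move: (near t) (near u).
    case: (dS t _) => [|?]; case: (dS u _) => [|?] et eu;
      case dT: (minn (uphalf _) (uphalf _)); lia.
  have /eq_ab/negbNE/eqP : inl x \in pendant_elements by rewrite inE x1.
  have /eq_ab/negbNE/eqP : inr e \in pendant_elements.
    by rewrite inE; apply/exists_inP; exists x; rewrite ?x1.
  rewrite !da !db !(total_dist connG) => eq_e eq_x.
  exact: etrans (near2 p q) (etrans (congr2 total eq_e eq_x) (esym (near2 r s))).
have sub (t u v w : subdivision G) :
    (forall l, @degree (subdivision G) l = 1 ->
      minn (dS t l) (dS u l) = minn (dS v l) (dS w l)) ->
    [set t; u] \subset [set v; w].
  move=> eq_l; rewrite subUset !sub1set.
  apply/andP; split.
    exact: (@leaf_dists_determine _ connS bridgeS t u v w eq_l).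
  apply: (@leaf_dists_determine _ connS bridgeS u t v w) => l /eq_l.
  by rewrite minnC.
apply/eqP; rewrite eqEsubset; apply/andP; split; apply: sub => l /eq_leaf //.
Qed.

End Pendant.

Theorem theorem4p3 (G : sgraph) (treeG : is_tree G) (G_neq_K2 : #|G| != 2) :
  mdim (total_graph G) = 2 * num_leaves G.
Proof.
have [_ connG _] := treeG; have bridgeG := tree_all_bridges treeG.
rewrite -card_pendant_elements // /mdim.
case: arg_minnP => [|S resS minS]; first exact: mixed_resolving_setT.
apply/eqP; rewrite eqn_leq minS ?pendant_elements_resolving //=.
exact/subset_leq_card/pendant_elements_forced.
Qed.
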